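(* Let $\delta t>0$, let $u_h^0\in X_h$, and let $(\tilde u_h^{n+1},u_h^{n+1},\lambda_h^{n+1})_{n\ge 0}$ be generated by the first-order positivity preserving scheme: for each $n\ge 0$, Step 1: $$\frac{\tilde u_h^{n+1}(\boldsymbol z)-u_h^n(\boldsymbol z)}{\delta t}+\mathcal L_h^n\tilde u_h^{n+1}(\boldsymbol z)=0,\qquad \forall \boldsymbol z\in\Sigma_h;$$ Step 2: $$\frac{u_h^{n+1}(\boldsymbol z)-\tilde u_h^{n+1}(\boldsymbol z)}{\delta t}=\lambda_h^{n+1}(\boldsymbol z),\quad \lambda_h^{n+1}(\boldsymbol z)\ge 0,\quad u_h^{n+1}(\boldsymbol z)\ge 0,\quad \lambda_h^{n+1}(\boldsymbol z)u_h^{n+1}(\boldsymbol z)=0,\qquad \forall \boldsymbol z\in\Sigma_h.$$ Then for all $m\ge 1$, $$\|u_h^m\|^2+\sum_{n=0}^{m-1}\left(\|\tilde u_h^{n+1}-u_h^n\|^2+\delta t^2\|\lambda_h^{n+1}\|^2\right)+2\delta t\sum_{n=0}^{m-1}\langle\mathcal L_h^n\tilde u_h^{n+1},\tilde u_h^{n+1}\rangle=\|u_h^0\|^2 .$$ In particular, if for all $n$ one has $\langle\mathcal L_h^n v_h,v_h\rangle\ge 0$ for all $v_h\in X_h$, then the scheme is dissipative and unconditionally stable, i.e. for every $\delta t>0$ (with no restriction on its size) $\|u_h^m\|\le\|u_h^0\|$ for all $m\ge 1$.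
   Context: $\Sigma_h$ is a finite set of mesh (collocation) points in $\bar\Omega$, and $X_h$ is a finite-dimensional space of real-valued functions such that for each $\boldsymbol z\in\Sigma_h$ there is a unique $\psi_{\boldsymbol z}\in X_h$ with $\psi_{\boldsymbol z}(\boldsymbol z')=\delta_{\boldsymbol z\boldsymbol z'}$ for all $\boldsymbol z'\in\Sigma_h$ (so functions in $X_h$ are identified with their values on $\Sigma_h$). Given weights $\omega_{\boldsymbol z}>0$, the discrete inner product and norm are $$[u,v]=\sum_{\boldsymbol z\in\Sigma_h}\omega_{\boldsymbol z}u(\boldsymbol z)v(\boldsymbol z),\qquad \|u\|=[u,u]^{1/2}.$$ For each $n\ge 0$, $\mathcal L_h^n$ is a given operator (linear or nonlinear) acting on $X_h$, an approximation at time $t_n$ of the spatial operator $\mathcal L$ in $u_t+\mathcal L u=0$; it may depend on previously computed quantities. $\langle\mathcal L_h^n v,w\rangle$ denotes the associated discrete form (after summation/integration by parts), which for $v,w\in X_h$ represents the discrete inner product $[\mathcal L_h^n v,w]$; that is, the discrete inner product of Step 1 with any $w\in X_h$ reads $\frac1{\delta t}[\tilde u_h^{n+1}-u_h^n,w]+\langle\mathcal L_h^n\tilde u_h^{n+1},w\rangle=0$. The functions $\tilde u_h^n,u_h^n,\lambda_h^n$ are real-valued, determined by their values on $\Sigma_h$. The solutions of the scheme are assumed to exist. *)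

(* Defs.v *)
From HB Require Import structures.
From mathcomp Require Import all_boot all_order all_algebra finmap.
From mathcomp Require Import all_classical all_reals topology normedtype.
Set Implicit Arguments.
Unset Strict Implicit.
Unset Printing Implicit Defensive.
Import Order.TTheory GRing.Theory Num.Theory.
Import numFieldNormedType.Exports.
Local Open Scope classical_set_scope.
Local Open Scope ring_scope.

Section Discretization.
Context {R : realType} {T : choiceType}.

(* The discrete inner product is only semidefinite on all functions [T -> R]:
   it sees nothing but the values on the mesh [Sigma]. *)
Definition dinner (Sigma : {fset T}) (omega : T -> R) (u v : T -> R) : R :=
  \sum_(z <- Sigma) omega z * u z * v z.

Definition dnorm (Sigma : {fset T}) (omega : T -> R) (u : T -> R) : R :=
  Num.sqrt (dinner Sigma omega u u).

(* A subspace of a finite span is finite-dimensional, so the [b i] need not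
   lie in [X]. *)
Definition finite_dimensional (X : submodClosed (T -> R)) : Prop :=
  exists (k : nat) (b : 'I_k -> T -> R), forall v : T -> R,
    v \in X -> exists c : 'I_k -> R, v = \sum_(i < k) c i *: b i.

Definition has_nodal_basis (Sigma : {fset T}) (X : submodClosed (T -> R)) :
    Prop :=
  forall z : T, z \in Sigma ->
    exists! psi : T -> R,
      psi \in X /\ forall z' : T, z' \in Sigma -> psi z' = (z == z')%:R.

(* [L n] is the operator L_h^n frozen at time level [n]: any dependence on
   previously computed quantities is absorbed in the arbitrary index [n].
   The values [ut 0] and [lam 0] are never used.  Only [u 0] and the arguments
   [ut n.+1] of the operators are required to lie in [X]; the corrected
   solution and the multiplier enter through their mesh values alone. *)
Record positivity_scheme (Sigma : {fset T}) (X : submodClosed (T -> R))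
    (L : nat -> (T -> R) -> T -> R) (dt : R) (ut u lam : nat -> T -> R) :
    Prop := {
  scheme_init : u 0%N \in X;
  scheme_pred : forall n : nat, ut n.+1 \in X;
  scheme_step1 : forall (n : nat) (z : T), z \in Sigma ->
    (ut n.+1 z - u n z) / dt + L n (ut n.+1) z = 0;
  scheme_step2 : forall (n : nat) (z : T), z \in Sigma ->
    [/\ (u n.+1 z - ut n.+1 z) / dt = lam n.+1 z,
        0 <= lam n.+1 z,
        0 <= u n.+1 z
      & lam n.+1 z * u n.+1 z = 0]
}.

End Discretization.

(* Main.v *)
(* Complementarity makes Step 2 an orthogonal projection: at each mesh point
   [p = b - dt * l] and [l * b = 0] give [p ^+ 2 = b ^+ 2 + (dt * l) ^+ 2].
   Testing Step 1 with [2 dt p] and the polarization identity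
   [2 (p - a) p = p ^+ 2 - a ^+ 2 + (p - a) ^+ 2] then balance the energy of one
   time step exactly; the balances telescope. *)
Require Import Defs.
From HB Require Import structures.
From mathcomp Require Import all_boot all_order all_algebra finmap.
From mathcomp Require Import all_classical all_reals topology normedtype.
From mathcomp Require Import ring.
Import Order.TTheory GRing.Theory Num.Theory.
Import numFieldNormedType.Exports.
Local Open Scope classical_set_scope.
Local Open Scope ring_scope.

(** Values at one mesh point: [a] of [u n], [p] of [ut n.+1], [b] of [u n.+1], [l] of [lam n.+1],
    [q] of [L n (ut n.+1)]. *)
Lemma nodal_energy_balance {F : fieldType} {dt a p b l q : F} :
  dt != 0 -> (p - a) / dt + q = 0 -> (b - p) / dt = l -> l * b = 0 ->
  b ^+ 2 + ((p - a) ^+ 2 + dt ^+ 2 * l ^+ 2) + 2 * dt * (q * p) = a ^+ 2.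
Proof.
move=> dt0 step1 step2 lb0.
have pE : p = b - dt * l by rewrite -step2; field.
have dq : dt * q = a - p.
  by move/eqP: step1; rewrite addrC addr_eq0 => /eqP ->; field.
have p2 : p ^+ 2 = b ^+ 2 + dt ^+ 2 * l ^+ 2.
  (* Expanding [(b - dt * l) ^+ 2] isolates the cross term that complementarity kills. *)
  transitivity (b ^+ 2 + dt ^+ 2 * l ^+ 2 - 2 * dt * (l * b)).
    by rewrite pE; ring.
  by rewrite lb0 mulr0 subr0.
(* Grouping [dt * q] lets Step 1 turn it into [a - p]; the polarization identity remains. *)
transitivity (p ^+ 2 + (p - a) ^+ 2 + 2 * (dt * q) * p).
  by rewrite p2; ring.
by rewrite dq; ring.
Qed.

(** [Num.sqrt] is 0 on negative numbers; positive weights keep its argument nonnegative, so squaring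
    undoes it. *)
Lemma dnorm_sqr (R : realType) (T : choiceType) (Sigma : {fset T})
    (omega u : T -> R) :
  (forall z, z \in Sigma -> 0 < omega z) ->
  dnorm Sigma omega u ^+ 2 = dinner Sigma omega u u.
Proof.
move=> omega_gt0; rewrite sqr_sqrtr // /dinner big_seq sumr_ge0 // => z zS.
by rewrite -mulrA -expr2 mulr_ge0 ?sqr_ge0 // ltW // omega_gt0.
Qed.

Lemma energy_balance_step {R : realType} {T : choiceType} {Sigma : {fset T}}
    {X : submodClosed (T -> R)} {omega : T -> R}
    {L : nat -> (T -> R) -> T -> R} {dt : R} {ut u lam : nat -> T -> R}
    (n : nat) :
  (forall z, z \in Sigma -> 0 < omega z) -> 0 < dt ->
  positivity_scheme Sigma X L dt ut u lam ->
  dnorm Sigma omega (u n.+1) ^+ 2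
  + (dnorm Sigma omega (ut n.+1 - u n) ^+ 2
     + dt ^+ 2 * dnorm Sigma omega (lam n.+1) ^+ 2)
  + 2 * dt * dinner Sigma omega (L n (ut n.+1)) (ut n.+1)
  = dnorm Sigma omega (u n) ^+ 2.
Proof.
move=> omega_gt0 dt_gt0 [_ _ step1 step2].
rewrite !dnorm_sqr // /dinner !mulr_sumr -!big_split /=.
(* [big_seq] records [z \in Sigma], where the equations of the scheme hold. *)
rewrite [LHS]big_seq [RHS]big_seq; apply: eq_bigr => z zS.
have [lE _ _ lb0] := step2 n z zS.
have dt_neq0 : dt != 0 by rewrite gt_eqF.
have e := nodal_energy_balance dt_neq0 (step1 n z zS) lE lb0.
transitivity (omega z * u n z ^+ 2); last by rewrite expr2 mulrA.
rewrite -e (_ : (ut n.+1 - u n) z = ut n.+1 z - u n z) //; ring.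
Qed.

Theorem theorem3p1 (R : realType) (d : nat) (Omega : set 'rV[R]_d)
  (Sigma : {fset closure Omega}) (X : submodClosed (closure Omega -> R))
  (omega : closure Omega -> R)
  (L : nat -> (closure Omega -> R) -> closure Omega -> R)
  (form : nat -> (closure Omega -> R) -> (closure Omega -> R) -> R)
  (Xfin : finite_dimensional X)
  (Xnodal : has_nodal_basis Sigma X)
  (omega_gt0 : forall z, z \in Sigma -> 0 < omega z)
  (LX : forall (n : nat) (v : closure Omega -> R), v \in X -> L n v \in X)
  (formE : forall (n : nat) (v w : closure Omega -> R), v \in X -> w \in X ->
    form n v w = dinner Sigma omega (L n v) w)
  (dt : R) (dt_gt0 : 0 < dt)
  (ut u lam : nat -> closure Omega -> R)
  (scheme : positivity_scheme Sigma X L dt ut u lam) :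
  (forall m : nat, (1 <= m)%N ->
    dnorm Sigma omega (u m) ^+ 2
    + \sum_(0 <= n < m)
        (dnorm Sigma omega (ut n.+1 - u n) ^+ 2
         + dt ^+ 2 * dnorm Sigma omega (lam n.+1) ^+ 2)
    + 2 * dt * \sum_(0 <= n < m) form n (ut n.+1) (ut n.+1)
    = dnorm Sigma omega (u 0%N) ^+ 2)
  /\
  ((forall (n : nat) (v : closure Omega -> R), v \in X -> 0 <= form n v v) ->
   forall m : nat, (1 <= m)%N ->
     dnorm Sigma omega (u m) <= dnorm Sigma omega (u 0%N)).
Proof.
have balance m : dnorm Sigma omega (u m) ^+ 2
    + \sum_(0 <= n < m)
        (dnorm Sigma omega (ut n.+1 - u n) ^+ 2
         + dt ^+ 2 * dnorm Sigma omega (lam n.+1) ^+ 2)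
    + 2 * dt * \sum_(0 <= n < m) form n (ut n.+1) (ut n.+1)
    = dnorm Sigma omega (u 0%N) ^+ 2.
  elim: m => [|m IHm]; first by rewrite !big_nil mulr0 !addr0.
  have utX := scheme_pred scheme m.
  (* Read right to left: the initial energy becomes the balance up to [m], then the energy of [u m]
     is expanded by one time step. [utX] lets [formE] identify the new form term with the inner
     product. *)
  rewrite -IHm -(energy_balance_step m omega_gt0 dt_gt0 scheme).
  by rewrite !big_nat_recr //= formE //; ring.
split=> [m _|form_ge0 m _]; first exact: balance.
(* Norms are nonnegative, so their squares may be compared; by [balance] these differ by the two
   dissipation sums. *)
rewrite -ler_sqr ?nnegrE ?sqrtr_ge0 // -(balance m) -addrA lerDl.
apply: addr_ge0.
  by apply: sumr_ge0 => n _; rewrite -exprMn addr_ge0 ?sqr_ge0.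
rewrite mulr_ge0 ?mulr_ge0 ?ler0n ?(ltW dt_gt0) // sumr_ge0 // => n _.
exact: form_ge0 (scheme_pred scheme n).
Qed.
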